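(* Let $\mathcal C$ be a category with a distinguished subcategory and an initial object $0$, let $H\in\mathrm{Hom}(\mathcal C^\square,\mathcal A)$ be a locally cellular relative homology with values in an abelian category $\mathcal A$, and let $X_\bullet\to X$ be a good filtration for $H$. Then for every $i$ there is a canonical isomorphism in $\mathcal A$ $$H_i(X)\cong H_i(C_*^H(X))$$ with the homology of the cellular complex $C_*^H(X)$, functorially with respect to morphisms of good filtrations.
   Context: All objects and all isomorphisms of $\mathcal C$ belong to the distinguished subcategory, and $0\to X$ is distinguished for all $X$. $\mathcal C^\square$ has as objects $(X,Y)$ the distinguished morphisms $Y\to X$ and as morphisms the commutative squares of $\mathcal C$. A relative homology $H\in\mathrm{Hom}(\mathcal C^\square,\mathcal A)$ is a family of functors $H_i:\mathcal C^\square\to\mathcal A$, $i\in\mathbb Z$, with boundary morphisms $\partial_i:H_i(X,Y)\to H_{i-1}(Y,Z)$ for all composable distinguished $Z\to Y\to X$, natural in morphisms of such triples, such that $\cdots\to H_i(Y,Z)\to H_i(X,Z)\to H_i(X,Y)\xrightarrow{\partial_i}H_{i-1}(Y,Z)\to\cdots$ is exact. $H_i(X):=H_i(X,0)$. A filtration $X_\bullet\to X$ is a sequence of distinguished (mono)morphisms $0=X_{-1}\to X_0\to\cdots\to X_{p-1}\to X_p\to\cdots$ with compatible distinguished (mono)morphisms $X_p\to X$; set $X_p=0$ for $p<0$. A pair $(X,Y)$ is cellular (good) for $H$ if either $Y\cong X$ or there is an integer $n$ with $H_i(X,Y)=0$ for $i\ne n$ and $H_n(X,Y)\ne0$. A filtration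 is good (cellular) for $H$ if for each $p\ge0$ the pair $(X_p,X_{p-1})$ is cellular and: $H_i(X_p,X_{p-1})=0$ for $i\ne p$; $H_i(X_p)=0$ for $i>p$; $H_i(X_p)\cong H_i(X)$ for $i<p$, induced by $X_p\to X$. $H$ is locally cellular if there are good filtrations for $H$ on (the objects of) a subcategory of $\mathcal C$. For a good filtration, $C^H_*(X)$ is the chain complex with $C^H_i(X)=H_i(X_i,X_{i-1})$ and differential the boundary $\partial_i:H_i(X_i,X_{i-1})\to H_{i-1}(X_{i-1},X_{i-2})$ of the triple $X_{i-2}\to X_{i-1}\to X_i$ (one has $\partial_{i-1}\partial_i=0$). A morphism of good filtrations is a morphism $f:X\to X'$ inducing compatible morphisms of pairs $(X_p,X_{p-1})\to(X'_p,X'_{p-1})$ on the corresponding good filtrations. *)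

(* Defs.v *)
From HB Require Import structures.
From mathcomp Require Import all_boot all_order all_algebra.
From mathcomp Require Import boolp.

Set Implicit Arguments.
Unset Strict Implicit.
Unset Printing Implicit Defensive.

Import GRing.Theory.
Local Open Scope ring_scope.

Declare Scope cat_scope.
Delimit Scope cat_scope with cat.
Local Open Scope cat_scope.

Record Category := MkCategory {
  Ob :> Type;
  Mor : Ob -> Ob -> Type;
  idm : forall X, Mor X X;
  compose : forall X Y Z, Mor Y Z -> Mor X Y -> Mor X Z;
  comp_idl : forall X Y (f : Mor X Y), compose (idm Y) f = f;
  comp_idr : forall X Y (f : Mor X Y), compose f (idm X) = f;
  compA : forall W X Y Z (h : Mor Y Z) (g : Mor X Y) (f : Mor W X),
    compose h (compose g f) = compose (compose h g) f }.

Arguments Mor {_} _ _.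
Arguments idm {_} _.
Arguments compose {_ _ _ _} _ _.

Notation "g ∘ f" := (compose g f) (at level 40, left associativity) : cat_scope.

Record Functor (C D : Category) := MkFunctor {
  fob :> C -> D;
  fmap : forall X Y : C, Mor X Y -> Mor (fob X) (fob Y);
  fmap_id : forall X : C, fmap (idm X) = idm (fob X);
  fmap_comp : forall (X Y Z : C) (g : Mor Y Z) (f : Mor X Y),
    fmap (g ∘ f) = fmap g ∘ fmap f }.

Section CategoryNotions.
Variable C : Category.
Implicit Types X Y Z : C.

Definition is_iso X Y (f : Mor X Y) : Prop :=
  exists g : Mor Y X, g ∘ f = idm X /\ f ∘ g = idm Y.

Definition isomorphic X Y : Prop := exists f : Mor X Y, is_iso f.

Definition is_mono X Y (f : Mor X Y) : Prop :=
  forall W (g h : Mor W X), f ∘ g = f ∘ h -> g = h.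

Definition is_epi X Y (f : Mor X Y) : Prop :=
  forall Z (g h : Mor Y Z), g ∘ f = h ∘ f -> g = h.

Record Subcategory := MkSubcategory {
  sub_ob : C -> Prop;
  sub_hom : forall X Y, Mor X Y -> Prop;
  sub_dom : forall X Y (f : Mor X Y), sub_hom f -> sub_ob X;
  sub_cod : forall X Y (f : Mor X Y), sub_hom f -> sub_ob Y;
  sub_idm : forall X, sub_ob X -> sub_hom (idm X);
  sub_comp : forall X Y Z (g : Mor Y Z) (f : Mor X Y),
    sub_hom g -> sub_hom f -> sub_hom (g ∘ f) }.

End CategoryNotions.

Definition homZ (C : Category) (zm : forall X Y : C, GRing.Zmodule (Mor X Y))
  (X Y : C) : zmodType := GRing.Zmodule.Pack (zm X Y).

Record PreadditiveCat := MkPreadditiveCat {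
  pre_cat :> Category;
  hom_zmod : forall X Y : pre_cat, GRing.Zmodule (Mor X Y);
  comp_addr : forall (X Y Z : pre_cat) (g : Mor Y Z),
    {morph (fun f : homZ hom_zmod X Y => (g ∘ f : homZ hom_zmod X Z))
      : f f' / f + f'};
  comp_addl : forall (X Y Z : pre_cat) (f : Mor X Y),
    {morph (fun g : homZ hom_zmod Y Z => (g ∘ f : homZ hom_zmod X Z))
      : g g' / g + g'} }.

HB.instance Definition _ (A : PreadditiveCat) (X Y : A) :=
  @hom_zmod A X Y.

Section PreadditiveNotions.
Variable A : PreadditiveCat.
Implicit Types X Y Z K Q : A.

Lemma comp0r X Y Z (g : Mor Y Z) : g ∘ (0 : Mor X Y) = 0.
Proof.
have h : g ∘ (0 : Mor X Y) + g ∘ (0 : Mor X Y) = g ∘ (0 : Mor X Y) + 0.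
  by rewrite addr0 -[in RHS](addr0 (0 : Mor X Y)); symmetry; apply: comp_addr.
exact: (addrI _ h).
Qed.

Lemma comp0l X Y Z (f : Mor X Y) : (0 : Mor Y Z) ∘ f = 0.
Proof.
have h : (0 : Mor Y Z) ∘ f + (0 : Mor Y Z) ∘ f = (0 : Mor Y Z) ∘ f + 0.
  by rewrite addr0 -[in RHS](addr0 (0 : Mor Y Z)); symmetry;
     apply: (comp_addl f).
exact: (addrI _ h).
Qed.

Definition is_kernel X Y K (f : Mor X Y) (k : Mor K X) : Prop :=
  f ∘ k = 0 /\
  forall W (g : Mor W X), f ∘ g = 0 -> exists! u : Mor W K, k ∘ u = g.

Definition is_cokernel X Y Q (f : Mor X Y) (q : Mor Y Q) : Prop :=
  q ∘ f = 0 /\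
  forall W (g : Mor Y W), g ∘ f = 0 -> exists! u : Mor Q W, u ∘ q = g.

Record Biproduct X Y := MkBiproduct {
  bip_ob : A;
  bip_in1 : Mor X bip_ob;
  bip_in2 : Mor Y bip_ob;
  bip_pr1 : Mor bip_ob X;
  bip_pr2 : Mor bip_ob Y;
  bip_11 : bip_pr1 ∘ bip_in1 = idm X;
  bip_22 : bip_pr2 ∘ bip_in2 = idm Y;
  bip_12 : bip_pr1 ∘ bip_in2 = 0;
  bip_21 : bip_pr2 ∘ bip_in1 = 0;
  bip_sum : bip_in1 ∘ bip_pr1 + bip_in2 ∘ bip_pr2 = idm bip_ob }.

End PreadditiveNotions.

Record AbelianCat := MkAbelianCat {
  ab_pre :> PreadditiveCat;
  ab_zero : ab_pre;
  ab_zero_initial : forall (X : ab_pre) (f : Mor ab_zero X), f = 0;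
  ab_zero_terminal : forall (X : ab_pre) (f : Mor X ab_zero), f = 0;
  ab_biproduct : forall X Y : ab_pre, Biproduct X Y;
  ker_ob : forall (X Y : ab_pre), Mor X Y -> ab_pre;
  ker_map : forall (X Y : ab_pre) (f : Mor X Y), Mor (ker_ob f) X;
  ker_map_is_kernel : forall (X Y : ab_pre) (f : Mor X Y),
    is_kernel f (ker_map f);
  coker_ob : forall (X Y : ab_pre), Mor X Y -> ab_pre;
  coker_map : forall (X Y : ab_pre) (f : Mor X Y), Mor Y (coker_ob f);
  coker_map_is_cokernel : forall (X Y : ab_pre) (f : Mor X Y),
    is_cokernel f (coker_map f);
  mono_is_kernel : forall (X Y : ab_pre) (f : Mor X Y), is_mono f ->
    exists (Z : ab_pre) (g : Mor Y Z), is_kernel g f;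
  epi_is_cokernel : forall (X Y : ab_pre) (f : Mor X Y), is_epi f ->
    exists (W : ab_pre) (g : Mor W X), is_cokernel g f }.

Section AbelianNotions.
Variable A : AbelianCat.
Implicit Types X Y Z : A.

Definition is_zero X : Prop := isomorphic X (ab_zero A).

Lemma ker_lift_subproof X Y (f : Mor X Y) W (g : Mor W X) :
  f ∘ g = 0 -> exists u : Mor W (ker_ob f), ker_map f ∘ u = g.
Proof.
by move=> fg0; have [_ /(_ W g fg0)[u [? _]]] := ker_map_is_kernel f; exists u.
Qed.

Definition ker_lift X Y (f : Mor X Y) W (g : Mor W X) (fg0 : f ∘ g = 0) :
  Mor W (ker_ob f) := sval (cid (ker_lift_subproof fg0)).

Lemma ker_liftK X Y (f : Mor X Y) W (g : Mor W X) (fg0 : f ∘ g = 0) :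
  ker_map f ∘ ker_lift fg0 = g.
Proof. exact: svalP (cid (ker_lift_subproof fg0)). Qed.

Lemma ker_comp0 X Y (f : Mor X Y) : f ∘ ker_map f = 0.
Proof. by case: (ker_map_is_kernel f). Qed.

Lemma ker_map_mono X Y (f : Mor X Y) : is_mono (ker_map f).
Proof.
move=> W g h gh; have [f0 /(_ W (ker_map f ∘ h))[]] := ker_map_is_kernel f.
  by rewrite compA f0 comp0l.
by move=> u [_ uu]; rewrite -(uu g gh) -(uu h erefl).
Qed.

Lemma coker_desc_subproof X Y (f : Mor X Y) W (g : Mor Y W) :
  g ∘ f = 0 -> exists u : Mor (coker_ob f) W, u ∘ coker_map f = g.
Proof.
by move=> gf0; have [_ /(_ W g gf0)[u [? _]]] := coker_map_is_cokernel f;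
  exists u.
Qed.

Definition coker_desc X Y (f : Mor X Y) W (g : Mor Y W) (gf0 : g ∘ f = 0) :
  Mor (coker_ob f) W := sval (cid (coker_desc_subproof gf0)).

Lemma coker_descK X Y (f : Mor X Y) W (g : Mor Y W) (gf0 : g ∘ f = 0) :
  coker_desc gf0 ∘ coker_map f = g.
Proof. exact: svalP (cid (coker_desc_subproof gf0)). Qed.

Lemma coker_comp0 X Y (f : Mor X Y) : coker_map f ∘ f = 0.
Proof. by case: (coker_map_is_cokernel f). Qed.

Definition im_ob X Y (f : Mor X Y) : A := ker_ob (coker_map f).
Definition im_map X Y (f : Mor X Y) : Mor (im_ob f) Y := ker_map (coker_map f).

Lemma im_factor X Y (f : Mor X Y) : exists u, im_map f ∘ u = f.
Proof. exact: ker_lift_subproof (coker_comp0 f). Qed.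

(* The image of f and the kernel of g agree as subobjects of Y. *)
Definition is_exact X Y Z (f : Mor X Y) (g : Mor Y Z) : Prop :=
  exists u : Mor (im_ob f) (ker_ob g), is_iso u /\ ker_map g ∘ u = im_map f.

Lemma exact_comp0 X Y Z (f : Mor X Y) (g : Mor Y Z) : is_exact f g -> g ∘ f = 0.
Proof.
case=> u [_ hu]; have [v <-] := im_factor f.
by rewrite -hu !compA ker_comp0 !comp0l.
Qed.

End AbelianNotions.

Section ChainComplexes.
Variable A : AbelianCat.

Record ChainComplex := MkChainComplex {
  ch_ob :> int -> A;
  ch_d : forall i, Mor (ch_ob i) (ch_ob (i - 1));
  ch_dd : forall i, ch_d (i - 1) ∘ ch_d i = 0 }.

Record ChainMap (K L : ChainComplex) := MkChainMap {
  ch_map :> forall i, Mor (K i) (L i);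
  ch_map_d : forall i, ch_map (i - 1) ∘ ch_d K i = ch_d L i ∘ ch_map i }.

(* The differential of degree i + 1, with its target K (i + 1 - 1) transported
   to K i. *)
Definition ch_d_in (K : ChainComplex) (i : int) : Mor (K (i + 1)) (K i) :=
  ecast j (Mor (K (i + 1)) (K j)) (addrK 1 i) (ch_d K (i + 1)).

Lemma ch_d_in0 (K : ChainComplex) (i : int) : ch_d K i ∘ ch_d_in K i = 0.
Proof.
have gen j (e : i + 1 - 1 = j) :
  ch_d K j ∘ ecast j (Mor (K (i + 1)) (K j)) e (ch_d K (i + 1)) = 0.
  by case: _ / e; apply: ch_dd.
exact: gen.
Qed.

Lemma ch_map_d_in (K L : ChainComplex) (f : ChainMap K L) (i : int) :
  f i ∘ ch_d_in K i = ch_d_in L i ∘ f (i + 1).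
Proof.
have gen j (e : i + 1 - 1 = j) :
  f j ∘ ecast j (Mor (K (i + 1)) (K j)) e (ch_d K (i + 1))
  = ecast j (Mor (L (i + 1)) (L j)) e (ch_d L (i + 1)) ∘ f (i + 1).
  by case: _ / e; apply: ch_map_d.
exact: gen.
Qed.

Definition boundary_to_cycles (K : ChainComplex) (i : int) :
  Mor (K (i + 1)) (ker_ob (ch_d K i)) :=
  ker_lift (ch_d_in0 K i).

Definition homology (K : ChainComplex) (i : int) : A :=
  coker_ob (boundary_to_cycles K i).

Definition homology_class (K : ChainComplex) (i : int) :
  Mor (ker_ob (ch_d K i)) (homology K i) := coker_map (boundary_to_cycles K i).

Lemma cycles_map_subproof (K L : ChainComplex) (f : ChainMap K L) (i : int) :
  ch_d L i ∘ (f i ∘ ker_map (ch_d K i)) = 0.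
Proof. by rewrite compA -ch_map_d -compA ker_comp0 comp0r. Qed.

Definition cycles_map (K L : ChainComplex) (f : ChainMap K L) (i : int) :
  Mor (ker_ob (ch_d K i)) (ker_ob (ch_d L i)) :=
  ker_lift (cycles_map_subproof f i).

Lemma homology_map_subproof (K L : ChainComplex) (f : ChainMap K L) (i : int) :
  (homology_class L i ∘ cycles_map f i) ∘ boundary_to_cycles K i = 0.
Proof.
have -> : (homology_class L i ∘ cycles_map f i) ∘ boundary_to_cycles K i
        = homology_class L i ∘ (boundary_to_cycles L i ∘ f (i + 1)).
  rewrite -compA; congr (_ ∘ _); apply: (@ker_map_mono A _ _ (ch_d L i)).
  by rewrite !compA !ker_liftK -compA ker_liftK ch_map_d_in.
by rewrite compA coker_comp0 comp0l.
Qed.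

Definition homology_map (K L : ChainComplex) (f : ChainMap K L) (i : int) :
  Mor (homology K i) (homology L i) := coker_desc (homology_map_subproof f i).

End ChainComplexes.

Record DistCat := MkDistCat {
  dc_cat :> Category;
  dc_sub : Subcategory dc_cat;
  dc_sub_ob : forall X : dc_cat, sub_ob dc_sub X;
  dc_sub_iso : forall (X Y : dc_cat) (f : Mor X Y),
    is_iso f -> sub_hom dc_sub f;
  zero_ob : dc_cat;
  from0 : forall X : dc_cat, Mor zero_ob X;
  from0_uniq : forall (X : dc_cat) (f : Mor zero_ob X), f = from0 X;
  dc_sub_from0 : forall X : dc_cat, sub_hom dc_sub (from0 X) }.

Arguments from0 {_} _.

Definition dist (D : DistCat) (X Y : D) (f : Mor X Y) : Prop :=
  sub_hom (dc_sub D) f.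

Lemma dist_comp (D : DistCat) (X Y Z : D) (g : Mor Y Z) (f : Mor X Y) :
  dist g -> dist f -> dist (g ∘ f).
Proof. exact: sub_comp. Qed.

Section Pairs.
Variable D : DistCat.

(* The pair (X, Y) given by inc : Y -> X, with X = amb and Y = sub. *)
Record Pair := MkPair {
  amb : D;
  sub : D;
  inc : Mor sub amb;
  inc_dist : dist inc }.

Record PairMor (P Q : Pair) := MkPairMor {
  amb_map : Mor (amb P) (amb Q);
  sub_map : Mor (sub P) (sub Q);
  pair_sq : amb_map ∘ inc P = inc Q ∘ sub_map }.

Lemma pair_mor_eq P Q (f g : PairMor P Q) :
  amb_map f = amb_map g -> sub_map f = sub_map g -> f = g.
Proof.
case: f g => [a b e] [a' b' e'] /= aa bb; subst a' b'.
by rewrite (Prop_irrelevance e e').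
Qed.

Definition pair_id P : PairMor P P :=
  @MkPairMor P P (idm _) (idm _)
    (etrans (comp_idl (inc P)) (esym (comp_idr (inc P)))).

Lemma pair_comp_subproof P Q R (g : PairMor Q R) (f : PairMor P Q) :
  (amb_map g ∘ amb_map f) ∘ inc P = inc R ∘ (sub_map g ∘ sub_map f).
Proof. by rewrite -compA pair_sq !compA pair_sq. Qed.

Definition pair_comp P Q R (g : PairMor Q R) (f : PairMor P Q) : PairMor P R :=
  MkPairMor (pair_comp_subproof g f).

Lemma pair_comp_idl P Q (f : PairMor P Q) : pair_comp (pair_id Q) f = f.
Proof. by apply: pair_mor_eq; rewrite /= comp_idl. Qed.

Lemma pair_comp_idr P Q (f : PairMor P Q) : pair_comp f (pair_id P) = f.
Proof. by apply: pair_mor_eq; rewrite /= comp_idr. Qed.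

Lemma pair_compA P Q R S (h : PairMor R S) (g : PairMor Q R)
  (f : PairMor P Q) :
  pair_comp h (pair_comp g f) = pair_comp (pair_comp h g) f.
Proof. by apply: pair_mor_eq; rewrite /= compA. Qed.

Definition PairCat : Category :=
  MkCategory pair_comp_idl pair_comp_idr pair_compA.

Definition abs_pair (X : D) : Pair := MkPair (dc_sub_from0 X).

Lemma abs_pair_map_subproof (X Y : D) (f : Mor X Y) :
  f ∘ inc (abs_pair X) = inc (abs_pair Y) ∘ idm (zero_ob D).
Proof. by rewrite comp_idr; apply: from0_uniq. Qed.

Definition abs_pair_map (X Y : D) (f : Mor X Y) :
  PairMor (abs_pair X) (abs_pair Y) :=
  @MkPairMor (abs_pair X) (abs_pair Y) f (idm (zero_ob D))
    (abs_pair_map_subproof f).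

Lemma abs_to_pair_subproof (P : Pair) :
  idm (amb P) ∘ inc (abs_pair (amb P)) = inc P ∘ from0 (sub P).
Proof. by rewrite comp_idl; symmetry; apply: from0_uniq. Qed.

(* (X, 0) -> (X, Y) *)
Definition abs_to_pair (P : Pair) : PairMor (abs_pair (amb P)) P :=
  @MkPairMor (abs_pair (amb P)) P (idm (amb P)) (from0 (sub P))
    (abs_to_pair_subproof P).

Record Triple := MkTriple {
  tX : D;
  tY : D;
  tZ : D;
  tYX : Mor tY tX;
  tZY : Mor tZ tY;
  tYX_dist : dist tYX;
  tZY_dist : dist tZY }.

Record TripleMor (T U : Triple) := MkTripleMor {
  tmX : Mor (tX T) (tX U);
  tmY : Mor (tY T) (tY U);
  tmZ : Mor (tZ T) (tZ U);
  tmYX : tmX ∘ tYX T = tYX U ∘ tmY;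
  tmZY : tmY ∘ tZY T = tZY U ∘ tmZ }.

Definition pairXY (T : Triple) : Pair := MkPair (tYX_dist T).
Definition pairYZ (T : Triple) : Pair := MkPair (tZY_dist T).
Definition pairXZ (T : Triple) : Pair :=
  MkPair (dist_comp (tYX_dist T) (tZY_dist T)).

Definition pairYZ_XZ (T : Triple) : PairMor (pairYZ T) (pairXZ T) :=
  @MkPairMor (pairYZ T) (pairXZ T) (tYX T) (idm (tZ T))
    (esym (comp_idr (tYX T ∘ tZY T))).

Definition pairXZ_XY (T : Triple) : PairMor (pairXZ T) (pairXY T) :=
  @MkPairMor (pairXZ T) (pairXY T) (idm (tX T)) (tZY T)
    (comp_idl (tYX T ∘ tZY T)).

Definition pairXY_map (T U : Triple) (t : TripleMor T U) :
  PairMor (pairXY T) (pairXY U) :=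
  @MkPairMor (pairXY T) (pairXY U) (tmX t) (tmY t) (tmYX t).

Definition pairYZ_map (T U : Triple) (t : TripleMor T U) :
  PairMor (pairYZ T) (pairYZ U) :=
  @MkPairMor (pairYZ T) (pairYZ U) (tmY t) (tmZ t) (tmZY t).

End Pairs.

Definition pair_fmap (D : DistCat) (C : Category) (G : Functor (PairCat D) C)
  (P Q : Pair D) (f : PairMor P Q) : Mor (G P) (G Q) := @fmap _ _ G P Q f.

Record RelHomology (D : DistCat) (A : AbelianCat) := MkRelHomology {
  rh :> int -> Functor (PairCat D) A;
  rh_bd : forall (i : int) (T : Triple D),
    Mor (rh i (pairXY T)) (rh (i - 1) (pairYZ T));
  rh_bd_nat : forall (i : int) (T U : Triple D) (t : TripleMor T U),
    pair_fmap (rh (i - 1)) (pairYZ_map t) ∘ rh_bd i T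
    = rh_bd i U ∘ pair_fmap (rh i) (pairXY_map t);
  rh_exact_XZ : forall (i : int) (T : Triple D),
    is_exact (pair_fmap (rh i) (pairYZ_XZ T)) (pair_fmap (rh i) (pairXZ_XY T));
  rh_exact_XY : forall (i : int) (T : Triple D),
    is_exact (pair_fmap (rh i) (pairXZ_XY T)) (rh_bd i T);
  rh_exact_YZ : forall (i : int) (T : Triple D),
    is_exact (rh_bd i T) (pair_fmap (rh (i - 1)) (pairYZ_XZ T)) }.

Section RelHomologyNotions.
Variables (D : DistCat) (A : AbelianCat) (H : RelHomology D A).

Definition rmap (i : int) (P Q : Pair D) (f : PairMor P Q) :
  Mor (H i P) (H i Q) := pair_fmap (H i) f.

Definition habs (i : int) (X : D) : A := H i (abs_pair X).

Definition habs_map (i : int) (X Y : D) (f : Mor X Y) :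
  Mor (habs i X) (habs i Y) := rmap i (abs_pair_map f).

Lemma rmap_comp i (P Q R : Pair D) (g : PairMor Q R) (f : PairMor P Q) :
  rmap i (pair_comp g f) = rmap i g ∘ rmap i f.
Proof. exact: (@fmap_comp _ _ (H i) P Q R g f). Qed.

Definition cellular_pair (P : Pair D) : Prop :=
  isomorphic (sub P) (amb P) \/
  exists n : int, (forall i, i != n -> is_zero (H i P)) /\ ~ is_zero (H n P).

End RelHomologyNotions.

Section Filtrations.
Variable D : DistCat.

Record Filtration (X : D) := MkFiltration {
  fil_ob : int -> D;
  fil_step : forall p, Mor (fil_ob (p - 1)) (fil_ob p);
  fil_to : forall p, Mor (fil_ob p) X;
  fil_ob_neg : forall p, p < 0 -> fil_ob p = zero_ob D;
  fil_step_dist : forall p, dist (fil_step p);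
  fil_to_dist : forall p, dist (fil_to p);
  fil_compat : forall p, fil_to p ∘ fil_step p = fil_to (p - 1) }.

Record FilMor (X X' : D) (F : Filtration X) (F' : Filtration X') := MkFilMor {
  fm_map : Mor X X';
  fm_lvl : forall p, Mor (fil_ob F p) (fil_ob F' p);
  fm_step : forall p,
    fm_lvl p ∘ fil_step F p = fil_step F' p ∘ fm_lvl (p - 1);
  fm_to : forall p, fm_map ∘ fil_to F p = fil_to F' p ∘ fm_lvl p }.

(* (X_p, X_{p-1}) *)
Definition fil_pair (X : D) (F : Filtration X) (p : int) : Pair D :=
  MkPair (fil_step_dist F p).

Definition fil_pair_map (X X' : D) (F : Filtration X) (F' : Filtration X')
  (f : FilMor F F') (p : int) : PairMor (fil_pair F p) (fil_pair F' p) :=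
  @MkPairMor D (fil_pair F p) (fil_pair F' p) (fm_lvl f p) (fm_lvl f (p - 1))
    (fm_step f p).

(* X_{p-2} -> X_{p-1} -> X_p *)
Definition fil_triple (X : D) (F : Filtration X) (p : int) : Triple D :=
  MkTriple (fil_step_dist F p) (fil_step_dist F (p - 1)).

Definition fil_triple_map (X X' : D) (F : Filtration X) (F' : Filtration X')
  (f : FilMor F F') (p : int) :
  TripleMor (fil_triple F p) (fil_triple F' p) :=
  @MkTripleMor D (fil_triple F p) (fil_triple F' p)
    (fm_lvl f p) (fm_lvl f (p - 1)) (fm_lvl f (p - 1 - 1))
    (fm_step f p) (fm_step f (p - 1)).

End Filtrations.

Section CellularComplex.
Variables (D : DistCat) (A : AbelianCat) (H : RelHomology D A).

Definition good_filtration (X : D) (F : Filtration X) : Prop :=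
  forall p : int, 0 <= p ->
  [/\ cellular_pair H (fil_pair F p),
      forall i : int, i != p -> is_zero (H i (fil_pair F p)),
      forall i : int, p < i -> is_zero (habs H i (fil_ob F p))
    & forall i : int, i < p -> is_iso (habs_map H i (fil_to F p))].

Record GoodFiltration := MkGoodFiltration {
  gf_ob : D;
  gf_fil :> Filtration gf_ob;
  gf_good : good_filtration gf_fil }.

Definition locally_cellular : Prop :=
  exists S : Subcategory D, forall X : D, sub_ob S X ->
  exists F : Filtration X, good_filtration F.

Section Complex.
Variables (X : D) (F : Filtration X).

Definition cell_ob (i : int) : A := H i (fil_pair F i).

Definition cell_d (i : int) : Mor (cell_ob i) (cell_ob (i - 1)) :=
  rh_bd H i (fil_triple F i).

Lemma cell_dd i : cell_d (i - 1) ∘ cell_d i = 0.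
Proof.
set X1 := fil_ob F (i - 1); set s := fil_step F (i - 1).
pose T : Triple D := MkTriple (fil_step_dist F i)
  (dist_comp (fil_step_dist F (i - 1)) (fil_step_dist F (i - 1 - 1))).
have t2 : idm X1 ∘ tZY T = tZY (fil_triple F i) ∘ fil_step F (i - 1 - 1).
  by rewrite comp_idl.
have t1 : idm (tX T) ∘ tYX T = tYX (fil_triple F i) ∘ idm X1.
  by rewrite comp_idl comp_idr.
pose t : TripleMor T (fil_triple F i) :=
  @MkTripleMor D T (fil_triple F i) _ _ _ t1 t2.
have nat := rh_bd_nat H i t.
have tid : pairXY_map t = pair_id (fil_pair F i) by exact: pair_mor_eq.
have t3 : pairYZ_map t = pairXZ_XY (fil_triple F (i - 1)).
  exact: pair_mor_eq.
rewrite tid /pair_fmap (@fmap_id _ _ (H i)) comp_idr t3 in nat.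
rewrite /cell_d -nat compA.
have -> := exact_comp0 (rh_exact_XY H (i - 1) (fil_triple F (i - 1))).
exact: comp0l.
Qed.

Definition cellular_complex : ChainComplex A := MkChainComplex cell_dd.

(* phi is the isomorphism induced by
   H_i(X) <- H_i(X_i) -> H_i(X_i, X_{i-1}). *)
Definition cellular_canonical (i : int)
  (phi : Mor (habs H i X) (homology cellular_complex i)) : Prop :=
  exists z : Mor (habs H i (fil_ob F i)) (ker_ob (ch_d cellular_complex i)),
    ker_map (ch_d cellular_complex i) ∘ z
      = rmap H i (abs_to_pair (fil_pair F i)) /\
    phi ∘ habs_map H i (fil_to F i) = homology_class cellular_complex i ∘ z.

End Complex.

Section ComplexMap.
Variables (X X' : D) (F : Filtration X) (F' : Filtration X') (f : FilMor F F').

Definition cell_map (i : int) : Mor (cell_ob F i) (cell_ob F' i) :=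
  rmap H i (fil_pair_map f i).

Lemma cell_map_d i : cell_map (i - 1) ∘ cell_d F i = cell_d F' i ∘ cell_map i.
Proof. exact: (rh_bd_nat H i (fil_triple_map f i)). Qed.

Definition cellular_map : ChainMap (cellular_complex F) (cellular_complex F') :=
  @MkChainMap A (cellular_complex F) (cellular_complex F') cell_map cell_map_d.

End ComplexMap.
End CellularComplex.

(* Main.v *)
From mathcomp Require Import all_boot all_order all_algebra.
From mathcomp Require Import boolp.
Require Import Defs.

(** The long exact sequences of the pairs (X_i, X_{i-1}) show, since
    H_i(X_{i-1}) = 0 for all i, that H_i(X_i) -> H_i(X_i, X_{i-1}) is a kernel
    of the cellular differential, i.e. that H_i(X_i) is the object of cellular
    cycles.  Under this identification the incoming differential becomes the
    boundary H_{i+1}(X_{i+1}, X_i) -> H_i(X_i) of a pair, and a cokernel of it is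
    H_i(X_i) -> H_i(X_{i+1}) = H_i(X), because H_i(X_{i+1}, X_i) = 0.
    Functoriality follows from the uniqueness of the induced map, since
    H_i(X_i) -> H_i(X) is epi. *)

Set Implicit Arguments.
Unset Strict Implicit.
Unset Printing Implicit Defensive.

Import Order.TTheory GRing.Theory Num.Theory.
Local Open Scope ring_scope.
Local Open Scope cat_scope.

(** * Kernels, cokernels and exactness in preadditive categories *)

Section Preadditive.
Variable A : PreadditiveCat.
Implicit Types X Y Z K Q : A.

Lemma mono_cancel0 X Y (f : Mor X Y) :
  (forall W (a : Mor W X), f ∘ a = 0 -> a = 0) -> is_mono f.
Proof.
move=> f0 W x y fxy; apply: subr0_eq; apply: f0.
apply: (@addIr _ (f ∘ y)); rewrite add0r -[RHS]fxy.
rewrite -[in RHS](subrK y x); symmetry; exact: (comp_addr f).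
Qed.

Lemma epi_cancel0 X Y (f : Mor X Y) :
  (forall W (a : Mor Y W), a ∘ f = 0 -> a = 0) -> is_epi f.
Proof.
move=> f0 W x y fxy; apply: subr0_eq; apply: f0.
apply: (@addIr _ (y ∘ f)); rewrite add0r -[RHS]fxy.
rewrite -[in RHS](subrK y x); symmetry; exact: (comp_addl f).
Qed.

Lemma idm0_from X Y (f : Mor X Y) : idm X = 0 -> f = 0.
Proof. by move=> X0; rewrite -[f]comp_idr X0 comp0r. Qed.

Lemma idm0_to X Y (f : Mor X Y) : idm Y = 0 -> f = 0.
Proof. by move=> Y0; rewrite -[f]comp_idl Y0 comp0l. Qed.

Lemma idm0_iso X Y (f : Mor X Y) : idm X = 0 -> idm Y = 0 -> is_iso f.
Proof. by move=> X0 Y0; exists 0; rewrite comp0l comp0r X0 Y0. Qed.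

Lemma kernel_mono X Y K (f : Mor X Y) (k : Mor K X) :
  is_kernel f k -> is_mono k.
Proof.
case=> fk0 ku W g h gh; have [|u [_ uu]] := ku W (k ∘ h).
  by rewrite compA fk0 comp0l.
by rewrite -(uu g gh) -(uu h erefl).
Qed.

Lemma cokernel_epi X Y Q (f : Mor X Y) (q : Mor Y Q) :
  is_cokernel f q -> is_epi q.
Proof.
case=> qf0 qu W g h gh; have [|u [_ uu]] := qu W (h ∘ q).
  by rewrite -compA qf0 comp0r.
by rewrite -(uu g gh) -(uu h erefl).
Qed.

Lemma kernel_iso X Y K K' (f : Mor X Y) (k : Mor K X) (k' : Mor K' X) :
  is_kernel f k -> is_kernel f k' -> exists2 u, is_iso u & k' ∘ u = k.
Proof.
move=> kk kk'; have [fk0 ku] := kk; have [fk'0 ku'] := kk'.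
have [u [uE _]] := ku' _ _ fk0; have [v [vE _]] := ku _ _ fk'0.
exists u => //; exists v; split.
  by apply: (kernel_mono kk); rewrite compA vE uE comp_idr.
by apply: (kernel_mono kk'); rewrite compA uE vE comp_idr.
Qed.

(** The isomorphism [z] is there to carry H_i(X_i) to the object of cellular cycles. *)
Lemma cokernel_iso X Y Y' Q Q' (f : Mor X Y) (q : Mor Y Q)
    (z : Mor Y Y') (q' : Mor Y' Q') :
  is_cokernel f q -> is_iso z -> is_cokernel (z ∘ f) q' ->
  exists2 u : Mor Q Q', is_iso u & u ∘ q = q' ∘ z.
Proof.
move=> cq [w [wz zw]] cq'; have [qf0 qu] := cq; have [qf0' qu'] := cq'.
have [|u [uE _]] := qu _ (q' ∘ z); first by rewrite -compA.
have [|v [vE _]] := qu' _ (q ∘ w).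
  by rewrite compA -(compA q w z) wz comp_idr.
exists u => //; exists v; split.
  by apply: (cokernel_epi cq); rewrite -compA uE compA vE -compA wz comp_idr comp_idl.
by apply: (cokernel_epi cq'); rewrite -compA vE compA uE -compA zw comp_idr comp_idl.
Qed.

(* In an abelian category this characterizes exactness; unlike [is_exact] it
   does not mention image objects, so it is visibly invariant under
   isomorphism. *)
Definition exact_at X Y Z (f : Mor X Y) (g : Mor Y Z) : Prop :=
  g ∘ f = 0 /\
  forall V W (a : Mor V Y) (h : Mor Y W), g ∘ a = 0 -> h ∘ f = 0 -> h ∘ a = 0.

Lemma exact_at_iso X Y Y' Z (f : Mor X Y) (g : Mor Y Z)
    (u : Mor Y Y') (v : Mor Y' Y) :
  v ∘ u = idm Y -> u ∘ v = idm Y' -> exact_at f g -> exact_at (u ∘ f) (g ∘ v).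
Proof.
move=> vu uv [gf0 fg]; split.
  by rewrite compA -(compA g) vu comp_idr.
move=> V W a h ga hf; rewrite -[h]comp_idr -uv compA -compA.
by apply: fg; rewrite ?compA // -compA.
Qed.

Lemma exact_at_mono X Y Z (f : Mor X Y) (g : Mor Y Z) :
  exact_at f g -> idm X = 0 -> is_mono g.
Proof.
move=> [_ fg] X0; apply: mono_cancel0 => W a ga.
by rewrite -[a]comp_idl; apply: fg => //; exact: idm0_from.
Qed.

Lemma exact_at_epi X Y Z (f : Mor X Y) (g : Mor Y Z) :
  exact_at f g -> idm Z = 0 -> is_epi f.
Proof.
move=> [_ fg] Z0; apply: epi_cancel0 => W a af.
by rewrite -[a]comp_idr; apply: fg => //; exact: idm0_to.
Qed.

End Preadditive.

(** * Exactness in abelian categories *)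

Section Abelian.
Variable A : AbelianCat.
Implicit Types X Y Z : A.

Lemma is_zero_idm0 X : is_zero X -> idm X = 0.
Proof.
by case=> u [v [<- _]]; rewrite (ab_zero_terminal u) comp0r.
Qed.

(** The map [a] factors through [ker_map g], hence through the image of [f], while [h] factors
    through [coker_map f], which kills that image. *)
Lemma is_exact_at X Y Z (f : Mor X Y) (g : Mor Y Z) :
  is_exact f g -> exact_at f g.
Proof.
move=> fg; split=> [|V W a h ga hf]; first exact: exact_comp0.
have [u [[v [_ uv]] uE]] := fg.
rewrite -(ker_liftK ga) -(coker_descK hf) -[ker_map g]comp_idr -uv.
by rewrite (compA _ u v) uE -!compA (compA _ (im_map f)) ker_comp0 comp0l comp0r.
Qed.

(** A mono [f] is the kernel of some [h]; by exactness [h] kills whatever [g] kills, so such maps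
    factor through [f]. *)
Lemma exact_at_kernel X Y Z (f : Mor X Y) (g : Mor Y Z) :
  exact_at f g -> is_mono f -> is_kernel g f.
Proof.
move=> [gf0 fg] fm; split=> // W a ga.
have [Z' [h [hf0 hu]]] := mono_is_kernel fm.
by apply: hu; apply: fg.
Qed.

Lemma exact_at_cokernel X Y Z (f : Mor X Y) (g : Mor Y Z) :
  exact_at f g -> is_epi g -> is_cokernel f g.
Proof.
move=> [gf0 fg] ge; split=> // W a af.
have [Z' [h [hg0 hu]]] := epi_is_cokernel ge.
by apply: hu; apply: fg.
Qed.

End Abelian.

(** * The long exact sequence of a pair *)

Section PairSequence.
Variables (D : DistCat) (A : AbelianCat) (H : RelHomology D A).

Lemma rmap_id i (P : Pair D) : rmap H i (pair_id P) = idm (H i P).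
Proof. exact: (@fmap_id _ _ (H i) P). Qed.

Lemma habs_map_comp i (X Y Z : D) (g : Mor Y Z) (f : Mor X Y) :
  habs_map H i (g ∘ f) = habs_map H i g ∘ habs_map H i f.
Proof.
rewrite /habs_map -rmap_comp; congr rmap.
by apply: pair_mor_eq; rewrite //= comp_idl.
Qed.

Variables (X Y : D) (s : Mor Y X) (ds : dist s).

Definition pair_triple : Triple D := MkTriple ds (dc_sub_from0 Y).

Definition pair_bd i : Mor (H i (MkPair ds)) (habs H (i - 1) Y) :=
  rh_bd H i pair_triple.

(** The inclusion of [pairXZ pair_triple] is [s ∘ from0 Y], which equals [from0 X] but is not
    convertible to it; [pair_collapse] and [pair_expand] bridge the two forms of (X, 0). *)
Lemma pair_collapse_subproof :
  idm X ∘ inc (pairXZ pair_triple) = inc (abs_pair X) ∘ idm (zero_ob D).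
Proof. by rewrite comp_idr; exact: from0_uniq. Qed.

Definition pair_collapse : PairMor (pairXZ pair_triple) (abs_pair X) :=
  @MkPairMor D (pairXZ pair_triple) (abs_pair X) _ _ pair_collapse_subproof.

Lemma pair_expand_subproof :
  idm X ∘ inc (abs_pair X) = inc (pairXZ pair_triple) ∘ idm (zero_ob D).
Proof. by rewrite comp_idl comp_idr; symmetry; exact: from0_uniq. Qed.

Definition pair_expand : PairMor (abs_pair X) (pairXZ pair_triple) :=
  @MkPairMor D (abs_pair X) (pairXZ pair_triple) _ _ pair_expand_subproof.

Lemma pair_expandK i :
  rmap H i pair_expand ∘ rmap H i pair_collapse
  = idm (H i (pairXZ pair_triple)).
Proof.
rewrite -rmap_comp -rmap_id; congr rmap.
by apply: pair_mor_eq; rewrite /= comp_idl.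
Qed.

Lemma pair_collapseK i :
  rmap H i pair_collapse ∘ rmap H i pair_expand = idm (habs H i X).
Proof.
rewrite -rmap_comp -rmap_id; congr rmap.
by apply: pair_mor_eq; rewrite /= comp_idl.
Qed.

Lemma habs_map_collapse i :
  habs_map H i s = rmap H i pair_collapse ∘ rmap H i (pairYZ_XZ pair_triple).
Proof.
rewrite -rmap_comp; congr rmap.
by apply: pair_mor_eq; rewrite /= comp_idl.
Qed.

Lemma abs_to_pair_expand i :
  rmap H i (abs_to_pair (MkPair ds))
  = rmap H i (pairXZ_XY pair_triple) ∘ rmap H i pair_expand.
Proof.
rewrite -rmap_comp; congr rmap.
by apply: pair_mor_eq; rewrite /= ?comp_idl ?comp_idr.
Qed.

Lemma exact_habs_amb i :
  exact_at (habs_map H i s) (rmap H i (abs_to_pair (MkPair ds))).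
Proof.
rewrite habs_map_collapse abs_to_pair_expand.
apply: exact_at_iso (pair_expandK i) (pair_collapseK i) _.
exact/is_exact_at/rh_exact_XZ.
Qed.

Lemma exact_habs_pair i :
  exact_at (rmap H i (abs_to_pair (MkPair ds))) (pair_bd i).
Proof.
have [bd0 bd_ex] := is_exact_at (rh_exact_XY H i pair_triple).
rewrite abs_to_pair_expand; split; first by rewrite compA bd0 comp0l.
move=> V W a h bda hj; apply: bd_ex => //.
by rewrite -[LHS]comp_idr -(pair_expandK i) compA -(compA h) hj comp0l.
Qed.

Lemma exact_habs_sub i : exact_at (pair_bd i) (habs_map H (i - 1) s).
Proof.
have [bd0 bd_ex] := is_exact_at (rh_exact_YZ H i pair_triple).
rewrite habs_map_collapse; split; first by rewrite -compA bd0 comp0r.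
move=> V W a h sa hbd; apply: bd_ex => //.
rewrite -[LHS]comp_idl -(pair_expandK (i - 1)).
by rewrite -compA (compA (rmap H (i - 1) pair_collapse)) sa comp0r.
Qed.

End PairSequence.

(** * Cellular cycles, boundaries and homology of a good filtration *)

Section GoodFiltrationHomology.
Variables (D : DistCat) (A : AbelianCat) (H : RelHomology D A).

(** In the sequence of the pair (0, 0), two consecutive maps are identities, and their composite
    vanishes. *)
Lemma habs_zero_ob i : idm (habs H i (zero_ob D)) = 0.
Proof.
have [+ _] := exact_habs_amb H (dc_sub_from0 (zero_ob D)) i.
have id0 : idm (zero_ob D) = from0 _ by exact: from0_uniq.
have -> : habs_map H i (from0 (zero_ob D)) = idm (habs H i (zero_ob D)).
  by rewrite /habs_map -rmap_id; congr rmap; apply: pair_mor_eq.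
have -> : rmap H i (abs_to_pair (MkPair (dc_sub_from0 (zero_ob D))))
          = idm (habs H i (zero_ob D)).
  by rewrite -rmap_id; congr rmap; exact: pair_mor_eq.
by rewrite comp_idl.
Qed.

Variables (X : D) (F : Filtration X).

Lemma habs_fil_neg i p : p < 0 -> idm (habs H i (fil_ob F p)) = 0.
Proof. by move/(fil_ob_neg F)=> ->; exact: habs_zero_ob. Qed.

(** This is naturality of the boundary along the morphism of triples from 0 → X_{p-1} → X_p to
    X_{p-2} → X_{p-1} → X_p. *)
Lemma cell_d_pair_bd p :
  cell_d H F p = rmap H (p - 1) (abs_to_pair (fil_pair F (p - 1)))
                 ∘ pair_bd H (fil_step_dist F p) p.
Proof.
pose T := pair_triple (fil_step_dist F p).
have tYXE : idm (tX T) ∘ tYX T = tYX (fil_triple F p) ∘ idm (tY T).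
  by rewrite comp_idl comp_idr.
have tZYE : idm (tY T) ∘ tZY T
            = tZY (fil_triple F p) ∘ from0 (fil_ob F (p - 1 - 1)).
  by rewrite comp_idl; symmetry; exact: from0_uniq.
pose t : TripleMor T (fil_triple F p) :=
  @MkTripleMor D T (fil_triple F p) _ _ _ tYXE tZYE.
have := rh_bd_nat H p t.
have -> : pairXY_map t = pair_id (fil_pair F p) by exact: pair_mor_eq.
have -> : pairYZ_map t = abs_to_pair (fil_pair F (p - 1)).
  exact: pair_mor_eq.
by rewrite [pair_fmap (H p) _]rmap_id comp_idr.
Qed.

Hypothesis good : good_filtration H F.

Lemma habs_fil_pred i : idm (habs H i (fil_ob F (i - 1))) = 0.
Proof.
have [i0|i0] := ltP (i - 1) 0; first exact: habs_fil_neg.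
have [_ _ + _] := good i0.
by move/(_ i); rewrite ltrBlDr ltrDl => /(_ isT) /is_zero_idm0.
Qed.

(** Goodness at p = 0 gives H_i(X) ≅ H_i(X_0), and H_i(X_0) is a quotient of H_i(X_{-1}) = 0 because
    H_i(X_0, X_{-1}) = 0. *)
Lemma habs_neg i : i < 0 -> idm (habs H i X) = 0.
Proof.
move=> i0; have [_ H0 _ /(_ i i0)[v [_ <-]]] := good (lexx 0).
have s_epi : is_epi (habs_map H i (fil_step F 0)).
  apply: exact_at_epi (exact_habs_amb H (fil_step_dist F 0) i) _.
  by apply/is_zero_idm0/H0; rewrite lt_eqF.
rewrite [v]idm0_to ?comp0r //; apply: s_epi.
by rewrite comp0l comp_idl; apply/idm0_from/habs_fil_neg.
Qed.

Lemma habs_step_epi p : is_epi (habs_map H (p - 1) (fil_step F p)).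
Proof.
(* Goodness is silent for p < 0, but there X_p is the zero object. *)
have [p0|p0] := ltP p 0.
  by move=> W g h _; rewrite [g]idm0_from ?[h]idm0_from //; exact: habs_fil_neg.
apply: exact_at_epi (exact_habs_amb H (fil_step_dist F p) (p - 1)) _.
have [_ Hp _ _] := good p0.
by apply/is_zero_idm0/Hp; rewrite lt_eqF // gtrBl.
Qed.

Lemma habs_to_iso p : is_iso (habs_map H (p - 1) (fil_to F p)).
Proof.
have [p0|p0] := ltP p 0.
  apply: idm0_iso; first exact: habs_fil_neg.
  by apply: habs_neg; rewrite (lt_trans _ p0) // gtrBl.
by have [_ _ _] := good p0; apply; rewrite gtrBl.
Qed.

Lemma fil_pair_mono i : is_mono (rmap H i (abs_to_pair (fil_pair F i))).
Proof.
exact: exact_at_mono (exact_habs_amb H (fil_step_dist F i) i) (habs_fil_pred i).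
Qed.

Lemma cell_cycles i :
  is_kernel (cell_d H F i) (rmap H i (abs_to_pair (fil_pair F i))).
Proof.
have [jbd0 jbd] := exact_at_kernel (exact_habs_pair H (fil_step_dist F i) i)
                                   (@fil_pair_mono i).
rewrite cell_d_pair_bd; split; first by rewrite -compA jbd0 comp0r.
(* The outer factor of the differential is the mono of degree i - 1, so the differential and
   [pair_bd] kill the same maps. *)
move=> W g dg0; apply: jbd; apply: fil_pair_mono.
by rewrite compA dg0 comp0r.
Qed.

Lemma habs_to_pred_cokernel p :
  is_cokernel (pair_bd H (fil_step_dist F p) p)
              (habs_map H (p - 1) (fil_to F (p - 1))).
Proof.
(* Factor X_{p-1} → X through X_p: in degree p - 1 the first map induces the cokernel and the second
   an isomorphism. *)
rewrite -fil_compat habs_map_comp.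
have [bd0 bdu] := exact_at_cokernel (exact_habs_sub H (fil_step_dist F p) p)
                                    (@habs_step_epi p).
have [v [vt tv]] := habs_to_iso p.
split; first by rewrite -compA bd0 comp0r.
move=> W g /bdu[u [uE uu]]; exists (u ∘ v); split.
  by rewrite compA -(compA u v) vt comp_idr.
move=> w wE; rewrite (uu (w ∘ habs_map H (p - 1) (fil_to F p))) -compA //.
by rewrite tv comp_idr.
Qed.

(* [ch_d_in] transports along (i + 1) - 1 = i; replacing i + 1 by a variable [p]
   makes the transport trivial. *)
Lemma habs_to_cokernel i :
  exists2 b : Mor (cell_ob H F (i + 1)) (habs H i (fil_ob F i)),
    rmap H i (abs_to_pair (fil_pair F i)) ∘ b
      = ch_d_in (cellular_complex H F) i
    & is_cokernel b (habs_map H i (fil_to F i)).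
Proof.
rewrite /ch_d_in; move: (i + 1) (addrK 1 i) => p e; case: _ / e => /=.
exists (pair_bd H (fil_step_dist F p) p).
  by rewrite -cell_d_pair_bd.
exact: habs_to_pred_cokernel.
Qed.

Lemma cellular_iso i :
  exists2 phi : Mor (habs H i X) (homology (cellular_complex H F) i),
    is_iso phi & cellular_canonical phi.
Proof.
have [z z_iso zE] := kernel_iso (cell_cycles i)
  (ker_map_is_kernel (ch_d (cellular_complex H F) i)).
have [b bE b_coker] := habs_to_cokernel i.
have zbE : z ∘ b = boundary_to_cycles (cellular_complex H F) i.
  apply: (ker_map_mono (f := ch_d (cellular_complex H F) i)).
  by rewrite compA zE bE ker_liftK.
(* H_i(X) is a cokernel of [b] and the homology is one of [z ∘ b]; [phi] compares them. *)
have [|phi phi_iso phiE] := cokernel_iso b_coker z_iso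
  (q' := homology_class (cellular_complex H F) i).
  by rewrite zbE; exact: coker_map_is_cokernel.
by exists phi => //; exists z.
Qed.

End GoodFiltrationHomology.

(** * Functoriality and the final isomorphism *)

Lemma cellular_canonical_natural (D : DistCat) (A : AbelianCat)
    (H : RelHomology D A) (X X' : D) (F : Filtration X) (F' : Filtration X')
    (f : FilMor F F') i
    (phi : Mor (habs H i X) (homology (cellular_complex H F) i))
    (phi' : Mor (habs H i X') (homology (cellular_complex H F') i)) :
  good_filtration H F -> cellular_canonical phi -> cellular_canonical phi' ->
  homology_map (cellular_map H f) i ∘ phi = phi' ∘ habs_map H i (fm_map f).
Proof.
move=> good [z [zE phiE]] [z' [zE' phiE']].
have [b _ /cokernel_epi to_epi] := habs_to_cokernel good i.
apply: to_epi.
rewrite -!compA phiE -habs_map_comp fm_to habs_map_comp !compA phiE'.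
rewrite coker_descK -!compA; congr (_ ∘ _).
(* Cycles embed in H_i(X'_i, X'_{i-1}), where the claim reduces to an equality of morphisms of pairs
   (X_i, 0) → (X'_i, X'_{i-1}). *)
apply: (ker_map_mono (f := ch_d (cellular_complex H F') i)).
rewrite compA ker_liftK compA zE' -compA zE /= /cell_map -!rmap_comp.
congr rmap; apply: pair_mor_eq; rewrite /= ?comp_idl ?comp_idr //.
exact: from0_uniq.
Qed.

Theorem proposition2p3p3 (D : DistCat) (A : AbelianCat) (H : RelHomology D A)
    (Hlc : locally_cellular H) :
  forall i : int,
  exists phi : forall F : GoodFiltration H,
      Mor (habs H i (gf_ob F)) (homology (cellular_complex H F) i),
    (forall F : GoodFiltration H, is_iso (phi F)) /\
    (forall F : GoodFiltration H, cellular_canonical (phi F)) /\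
    (forall (F F' : GoodFiltration H) (f : FilMor F F'),
       homology_map (cellular_map H f) i ∘ phi F
       = phi F' ∘ habs_map H i (fm_map f))%cat.
Proof.
move=> i.
(* Choosing [phi] separately for each filtration is harmless: naturality follows from
   [cellular_canonical]. *)
pose phi (F : GoodFiltration H) := cid2 (cellular_iso (gf_good F) i).
have phi_iso F : is_iso (s2val (phi F)) by exact: s2valP.
have phi_can F : cellular_canonical (s2val (phi F)) by exact: s2valP'.
exists (fun F => s2val (phi F)); split=> //; split=> // F F' f.
exact: cellular_canonical_natural (gf_good F) (phi_can F) (phi_can F').
Qed.
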